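(* In the setting of the context, suppose Property (P) holds with radius $R>0$ and functions $q_1,q_2,q_3$ (with constants $C_1,C_2,C_3$), and let $\mathrm{ALG}$ be a predictive online controller with states $x_t$ and per-step errors $e_t$. If $e_\tau\le R/(C_3^2L_g)$ for all time steps $\tau<t$, then $x_t\in\mathcal{B}(x_t^*,R/C_3)$. Further, if $e_t\le R/(C_3^2L_g)$ for all $t<T$, then the dynamic regret of $\mathrm{ALG}$ is upper bounded by $$\mathrm{cost}(\mathrm{ALG})-\mathrm{cost}(\mathrm{OPT})=O\left(\sqrt{\mathrm{cost}(\mathrm{OPT})\cdot\sum_{t=0}^{T-1}e_t^2}+\sum_{t=0}^{T-1}e_t^2\right).$$
   Context: Notation: $\|\cdot\|$ is the Euclidean norm, $\mathcal{B}(x,r)$ the closed ball of radius $r$ around $x$, and $\alpha_{t_1:t_2}=(\alpha_{t_1},\dots,\alpha_{t_2})$. The constant hidden in $O(\cdot)$ depends only on $\ell$, $L_g$, $C_3$ (defined below), not on $T$, $k$ or the prediction errors. Online control problem. States $x_t\in\mathbb{R}^n$, actions $u_t\in\mathbb{R}^m$, horizon $T$. Stage costs $f_t(x,u;\xi_t)$, dynamics $g_t(x,u;\xi_t)$, constraint functions $s_t(x,u;\xi_t)$ for $0\le t<T$ and terminal cost $F_T(x;\xi_T)$ are function families parameterized by $\xi_t\in\Xi_t$, where $\Xi_t$ has diameter at most $1$. The true parameters are $\xi_t^*\in\Xi_t$. The problem is to minimize $\sum_{t=0}^{T-1}f_t(x_t,u_t;\xi_t^* )+F_T(x_T;\xi_T^*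 )$ over $x_{0:T},u_{0:T-1}$ subject to $x_{t+1}=g_t(x_t,u_t;\xi_t^* )$, $s_t(x_t,u_t;\xi_t^* )\le 0$ for $0\le t<T$, and $x_0=x(0)$. Its optimal trajectory (with full knowledge of $\xi^*_{0:T}$) is $\mathrm{OPT}$, with states $x_t^*$ and actions $u_t^*$. For a controller, $\mathrm{cost}$ is the total cost $\sum_{t=0}^{T-1}f_t(x_t,u_t;\xi_t^* )+F_T(x_T;\xi_T^* )$ along its trajectory $x_0=x(0)$, $x_{t+1}=g_t(x_t,u_t;\xi_t^* )$; $\mathrm{cost}(\mathrm{OPT})$ is the optimal value. Standing assumptions: (i) $\|x_t^*\|\le D_{x^*}$ for all $t$; (ii) $\|g_t(x,u;\xi_t^* )-g_t(x,u';\xi_t^* )\|\le L_g\|u-u'\|$ for all feasible $x,u,u'$; (iii) $f_t(\cdot,\cdot;\xi_t^* )$ and $F_T(\cdot;\xi_T^* )$ are nonnegative, convex and $\ell$-smooth. Predictions and controllers. With prediction horizon $k$ ($1\le k\le T$), at time $t$ the controller receives $\xi_{\tau\mid t}\in\Xi_\tau$ for $t\le\tau\le\min\{t+k,T\}$. A predictive online controller $\mathrm{ALG}$ is a function choosing $u_t=\mathrm{ALG}(x_t,\xi_{t:\min\{t+k,T\}\mid t})$. FTOCP. For $t_1<t_2$, initial state $z$, parameters $\xi_{t_1:t_2-1}$, terminal parameter $\zeta_{t_2}$ (also written $\xi_{t_2}$, not necessarily in $\Xi_{t_2}$) and terminal cost $F$ (possibly $+\infty$-valued), $\psi_{t_1}^{t_2}(z,\xi_{t_1:t_2-1},\zeta_{t_2};F)$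 denotes an optimal solution of: minimize $\sum_{t=t_1}^{t_2-1}f_t(y_t,v_t;\xi_t)+F(y_{t_2};\zeta_{t_2})$ over $y_{t_1:t_2},v_{t_1:t_2-1}$ subject to $y_{t+1}=g_t(y_t,v_t;\xi_t)$, $s_t(y_t,v_t;\xi_t)\le0$ for $t_1\le t<t_2$, $y_{t_1}=z$. Subscripts $y_t$, $v_t$ select entries of the solution. $\mathbb{I}$ is the indicator terminal cost: $\mathbb{I}(y;\zeta)=0$ if $y=\zeta$, $+\infty$ otherwise ($\zeta\in\mathbb{R}^n$). Per-step error of $\mathrm{ALG}$: $e_t=\|u_t-\psi_t^T(x_t,\xi_{t:T}^*;F_T)_{v_t}\|$. Property (P), with radius $R>0$ and nonnegative functions $q_1,q_2,q_3$ on $\{0,1,2,\dots\}$ such that $\lim_{t\to\infty}q_i(t)=0$ for $i=1,2$ and $\sum_{t=0}^\infty q_i(t)\le C_i$, $C_i\ge1$, $i=1,2,3$, means: (a) The bound $$\|\psi_{t_1}^{t_2}(z,\xi_{t_1:t_2};F)_{v_{t_1}}-\psi_{t_1}^{t_2}(z,\xi'_{t_1:t_2};F)_{v_{t_1}}\|\le\Big(\sum_{t=t_1}^{t_2}q_1(t-t_1)\delta_t\Big)\|z\|+\sum_{t=t_1}^{t_2}q_2(t-t_1)\delta_t,\quad \delta_t=\|\xi_t-\xi'_t\|,$$ holds: for $t_1=t$, $t_2=t+k$, $t<T-k$, with $F=\mathbb{I}$, $z\in\mathcal{B}(x_t^*,R)$, $\xi_{t:t+k-1}\in\Xi_t\times\cdots\times\Xi_{t+k-1}$,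 $\xi'_{t:t+k-1}=\xi^*_{t:t+k-1}$, and $\xi_{t+k},\xi'_{t+k}\in\mathcal{B}(x_{t+k}^*,R)\subseteq\mathbb{R}^n$; and for $t_1=t$, $t_2=T$, $t\ge T-k$, with $F=F_T$, $z\in\mathcal{B}(x_t^*,R)$, $\xi_{t:T}\in\Xi_t\times\cdots\times\Xi_T$, $\xi'_{t:T}=\xi^*_{t:T}$. (b) For every $t_1<T$, $t_2=T$, $F=F_T$, all $z,z'\in\mathcal{B}(x_{t_1}^*,R)$, and all $t\in[t_1,T]$, $$\|\psi_{t_1}^{T}(z,\xi^*_{t_1:T};F_T)_{y_t/v_t}-\psi_{t_1}^{T}(z',\xi^*_{t_1:T};F_T)_{y_t/v_t}\|\le q_3(t-t_1)\|z-z'\|,$$ where $y_t/v_t$ means the bound holds for both the $y_t$ entry and (for $t<T$) the $v_t$ entry.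
   Formalization: The Lipschitz bound (ii) is also assumed at the state-action pairs visited by ALG, even if they violate the true constraints (the claim fails otherwise); the bounds in Property (P) are required of all optimal solutions, with existence of optimal solutions in (b). *)

(* Defs.v *)
From HB Require Import structures.
From mathcomp Require Import all_boot all_order all_algebra.
From mathcomp Require Import all_classical all_reals all_analysis.

Set Implicit Arguments.
Unset Strict Implicit.
Unset Printing Implicit Defensive.

Import Order.TTheory GRing.Theory Num.Theory.
Import numFieldNormedType.Exports.

Local Open Scope classical_set_scope.
Local Open Scope ring_scope.

(* The library norm `|x| on matrices is the sup norm, hence this definition. *)
Definition enorm (R : realType) (d : nat) (x : 'cV[R]_d) : R :=
  Num.sqrt (\sum_(i < d) x i ord0 ^+ 2).

Definition eball (R : realType) (d : nat) (x : 'cV[R]_d) (r : R) :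
    set 'cV[R]_d :=
  [set y | enorm (y - x) <= r].

Definition gradient (R : realType) (d : nat) (h : 'cV[R]_d -> R)
    (w : 'cV[R]_d) : 'cV[R]_d :=
  \col_i 'D_(delta_mx i ord0) h w.

Definition smooth (R : realType) (d : nat) (ell : R) (h : 'cV[R]_d -> R) :
    Prop :=
  (forall w : 'cV[R]_d, differentiable h w) /\
  (forall w w' : 'cV[R]_d,
     enorm (gradient h w - gradient h w') <= ell * enorm (w - w')).

Definition nonneg_convex_smooth (R : realType) (d : nat) (ell : R)
    (h : 'cV[R]_d -> R) : Prop :=
  [/\ forall w, 0 <= h w,
      @convex_function R 'cV[R]_d setT h
    & smooth ell h].

(* An instance of the online control problem.  The parameter sets Xi t are
   subsets of Euclidean spaces whose dimension may vary with t; only the times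
   t < horizon (t <= horizon for parameters) are meaningful.  The
   vector-valued constraint s_t <= 0 is understood componentwise. *)
Record ocp (R : realType) (n m : nat) := Ocp {
  horizon : nat;
  pdim : nat -> nat;
  cdim : nat -> nat;
  Xi : forall t, set 'cV[R]_(pdim t);
  xi_true : forall t, 'cV[R]_(pdim t);
  stage_cost : forall t, 'cV[R]_n -> 'cV[R]_m -> 'cV[R]_(pdim t) -> R;
  dynamics : forall t, 'cV[R]_n -> 'cV[R]_m -> 'cV[R]_(pdim t) -> 'cV[R]_n;
  constr : forall t,
    'cV[R]_n -> 'cV[R]_m -> 'cV[R]_(pdim t) -> 'cV[R]_(cdim t);
  term_cost : 'cV[R]_n -> 'cV[R]_(pdim horizon) -> R;
  x_init : 'cV[R]_n
}.
Arguments Xi {R n m} o t _.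

(* States and actions; entries outside the time window of the problem at hand
   are irrelevant. *)
Definition traj (R : realType) (n m : nat) : Type :=
  ((nat -> 'cV[R]_n) * (nat -> 'cV[R]_m))%type.

Definition param_seq (R : realType) (n m : nat) (pb : ocp R n m) : Type :=
  forall t, 'cV[R]_(pdim pb t).

Definition params_ok (R : realType) (n m : nat) (pb : ocp R n m) : Prop :=
  (forall t xi xi', (t <= horizon pb)%N -> Xi pb t xi -> Xi pb t xi' ->
     enorm (xi - xi') <= 1) /\
  (forall t, (t <= horizon pb)%N -> Xi pb t (xi_true pb t)).

Definition constr_sat (R : realType) (n m : nat) (pb : ocp R n m) (t : nat)
    (x : 'cV[R]_n) (u : 'cV[R]_m) (xi : 'cV[R]_(pdim pb t)) : Prop :=
  forall i, constr x u xi i ord0 <= 0.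

(* The finite-time optimal control problem (FTOCP) on [t1, t2]; the terminal
   parameter zeta may live in any type Z. *)

Definition ftocp_feasible (R : realType) (n m : nat) (pb : ocp R n m)
    (t1 t2 : nat) (z : 'cV[R]_n) (xi : param_seq pb) (s : traj R n m) : Prop :=
  s.1 t1 = z /\
  forall t, (t1 <= t < t2)%N ->
    s.1 t.+1 = dynamics (s.1 t) (s.2 t) (xi t) /\
    constr_sat (s.1 t) (s.2 t) (xi t).

Definition ftocp_cost (R : realType) (n m : nat) (pb : ocp R n m)
    (t1 t2 : nat) (xi : param_seq pb) (Z : Type) (zeta : Z)
    (F : 'cV[R]_n -> Z -> \bar R) (s : traj R n m) : \bar R :=
  ((\sum_(t1 <= t < t2) stage_cost (s.1 t) (s.2 t) (xi t))%:E
   + F (s.1 t2) zeta)%E.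

(* An optimal solution has finite cost: an infinite terminal cost is a
   violated terminal constraint. *)
Definition ftocp_opt (R : realType) (n m : nat) (pb : ocp R n m)
    (t1 t2 : nat) (z : 'cV[R]_n) (xi : param_seq pb) (Z : Type) (zeta : Z)
    (F : 'cV[R]_n -> Z -> \bar R) : set (traj R n m) :=
  [set s | [/\ ftocp_feasible t1 t2 z xi s,
               (ftocp_cost t1 t2 xi zeta F s < +oo)%E
             & forall s', ftocp_feasible t1 t2 z xi s' ->
                 (ftocp_cost t1 t2 xi zeta F s
                  <= ftocp_cost t1 t2 xi zeta F s')%E]].

Definition indicator_cost (R : realType) (n : nat) (y zeta : 'cV[R]_n) :
    \bar R :=
  if y == zeta then 0%E else +oo%E.

Definition terminal_cost (R : realType) (n m : nat) (pb : ocp R n m)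
    (y : 'cV[R]_n) (zeta : 'cV[R]_(pdim pb (horizon pb))) : \bar R :=
  (term_cost y zeta)%:E.

(* The solutions of the FTOCP on [t, T] with terminal cost F_T. *)
Definition tail_opt (R : realType) (n m : nat) (pb : ocp R n m) (t : nat)
    (z : 'cV[R]_n) (xi : param_seq pb) : set (traj R n m) :=
  ftocp_opt t (horizon pb) z xi (xi (horizon pb)) (@terminal_cost R n m pb).

(* psi_t^T(z, xi_{t:T}; F_T): an optimal solution (a dummy trajectory if there
   is none). *)
Definition psi_tail (R : realType) (n m : nat) (pb : ocp R n m) (t : nat)
    (z : 'cV[R]_n) (xi : param_seq pb) : traj R n m :=
  xget ((fun=> 0), (fun=> 0)) (tail_opt t z xi).

Definition is_OPT (R : realType) (n m : nat) (pb : ocp R n m)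
    (opt : traj R n m) : Prop :=
  tail_opt 0 (x_init pb) (xi_true pb) opt.

Definition cost (R : realType) (n m : nat) (pb : ocp R n m)
    (s : traj R n m) : R :=
  \sum_(0 <= t < horizon pb) stage_cost (s.1 t) (s.2 t) (xi_true pb t)
  + term_cost (s.1 (horizon pb)) (xi_true pb (horizon pb)).

(* The window t <= tau <= min(t + k, T) is indexed by tau = t + j with
   j <= min(k, T - t). *)
Definition controller (R : realType) (n m : nat) (pb : ocp R n m) (k : nat) :
    Type :=
  forall t, 'cV[R]_n ->
    (forall j : 'I_(minn k (horizon pb - t)).+1, 'cV[R]_(pdim pb (t + j))) ->
    'cV[R]_m.

(* pred t tau is the prediction xi_{tau | t} of the parameter at time tau
   received at time t. *)
Definition predictions_ok (R : realType) (n m : nat) (pb : ocp R n m)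
    (k : nat) (pred : nat -> param_seq pb) : Prop :=
  forall t tau, (t < horizon pb)%N ->
    (t <= tau <= minn (t + k) (horizon pb))%N -> Xi pb tau (pred t tau).

Definition alg_action_at (R : realType) (n m : nat) (pb : ocp R n m)
    (k : nat) (ALG : controller pb k) (pred : nat -> param_seq pb)
    (t : nat) (x : 'cV[R]_n) : 'cV[R]_m :=
  ALG t x (fun j => pred t (t + j)%N).

Fixpoint alg_state (R : realType) (n m : nat) (pb : ocp R n m)
    (k : nat) (ALG : controller pb k) (pred : nat -> param_seq pb)
    (t : nat) : 'cV[R]_n :=
  if t is t'.+1 then
    let x := alg_state ALG pred t' in
    dynamics x (alg_action_at ALG pred t' x) (xi_true pb t')
  else x_init pb.

Definition alg_traj (R : realType) (n m : nat) (pb : ocp R n m)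
    (k : nat) (ALG : controller pb k) (pred : nat -> param_seq pb) :
    traj R n m :=
  (alg_state ALG pred,
   fun t => alg_action_at ALG pred t (alg_state ALG pred t)).

Definition step_error (R : realType) (n m : nat) (pb : ocp R n m)
    (s : traj R n m) (t : nat) : R :=
  enorm (s.2 t - (psi_tail t (s.1 t) (xi_true pb)).2 t).

(* The state-action pairs called feasible in the Lipschitz assumption: those
   satisfying the true constraints and those visited by the controller's
   trajectory s.  If s satisfies the constraints, these are just the former;
   in general a controller acting on inexact predictions need not. *)
Definition feasible_pair (R : realType) (n m : nat) (pb : ocp R n m)
    (s : traj R n m) (t : nat) (x : 'cV[R]_n) (u : 'cV[R]_m) : Prop :=
  constr_sat x u (xi_true pb t) \/ (x = s.1 t /\ u = s.2 t).

Definition dynamics_lipschitz (R : realType) (n m : nat) (pb : ocp R n m)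
    (s : traj R n m) (Lg : R) : Prop :=
  forall t x u u', (t < horizon pb)%N ->
    feasible_pair pb s t x u -> feasible_pair pb s t x u' ->
    enorm (dynamics x u (xi_true pb t) - dynamics x u' (xi_true pb t))
      <= Lg * enorm (u - u').

Definition costs_regular (R : realType) (n m : nat) (pb : ocp R n m)
    (ell : R) : Prop :=
  (forall t, (t < horizon pb)%N ->
     nonneg_convex_smooth ell (fun w : 'cV[R]_(n + m) =>
       stage_cost (usubmx w) (dsubmx w) (xi_true pb t))) /\
  nonneg_convex_smooth ell (fun y : 'cV[R]_n =>
    term_cost y (xi_true pb (horizon pb))).

Definition gain_bounded (R : realType) (q : nat -> R) (C : R) : Prop :=
  [/\ forall t, 0 <= q t,
      1 <= C
    & (\sum_(0 <= t <oo) (q t)%:E <= C%:E)%E].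

Definition perturbation_bound (R : realType) (n : nat) (q1 q2 : nat -> R)
    (t1 t2 : nat) (delta : nat -> R) (z : 'cV[R]_n) : R :=
  (\sum_(t1 <= tau < t2.+1) q1 (tau - t1)%N * delta tau) * enorm z
  + \sum_(t1 <= tau < t2.+1) q2 (tau - t1)%N * delta tau.

(* In the clauses below psi stands for an unspecified optimal solution, so the
   bounds are required of all optimal solutions s, s' of the two problems
   compared. *)

Definition prop_a_indicator (R : realType) (n m : nat) (pb : ocp R n m)
    (k : nat) (opt : traj R n m) (rad : R) (q1 q2 : nat -> R) : Prop :=
  forall t z (xi : param_seq pb) (zeta zeta' : 'cV[R]_n) (s s' : traj R n m),
    (t + k < horizon pb)%N ->
    eball (opt.1 t) rad z ->
    (forall tau, (t <= tau < t + k)%N -> Xi pb tau (xi tau)) ->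
    eball (opt.1 (t + k)%N) rad zeta ->
    eball (opt.1 (t + k)%N) rad zeta' ->
    ftocp_opt t (t + k) z xi zeta (@indicator_cost R n) s ->
    ftocp_opt t (t + k) z (xi_true pb) zeta' (@indicator_cost R n) s' ->
    enorm (s.2 t - s'.2 t) <=
      perturbation_bound q1 q2 t (t + k)
        (fun tau => if tau == (t + k)%N then enorm (zeta - zeta')
                    else enorm (xi tau - xi_true pb tau)) z.

Definition prop_a_terminal (R : realType) (n m : nat) (pb : ocp R n m)
    (k : nat) (opt : traj R n m) (rad : R) (q1 q2 : nat -> R) : Prop :=
  forall t z (xi : param_seq pb) (s s' : traj R n m),
    (horizon pb - k <= t < horizon pb)%N ->
    eball (opt.1 t) rad z ->
    (forall tau, (t <= tau <= horizon pb)%N -> Xi pb tau (xi tau)) ->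
    tail_opt t z xi s ->
    tail_opt t z (xi_true pb) s' ->
    enorm (s.2 t - s'.2 t) <=
      perturbation_bound q1 q2 t (horizon pb)
        (fun tau => enorm (xi tau - xi_true pb tau)) z.

(* The first clause is the well-definedness of psi_{t1}^T(z, xi*; F_T) on the
   ball, which the bound in the second one presupposes. *)
Definition prop_b (R : realType) (n m : nat) (pb : ocp R n m)
    (opt : traj R n m) (rad : R) (q3 : nat -> R) : Prop :=
  (forall t1 z, (t1 < horizon pb)%N -> eball (opt.1 t1) rad z ->
     exists s, tail_opt t1 z (xi_true pb) s) /\
  (forall t1 z z' (s s' : traj R n m) t, (t1 < horizon pb)%N ->
     eball (opt.1 t1) rad z -> eball (opt.1 t1) rad z' ->
     tail_opt t1 z (xi_true pb) s -> tail_opt t1 z' (xi_true pb) s' ->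
     (t1 <= t <= horizon pb)%N ->
     enorm (s.1 t - s'.1 t) <= q3 (t - t1)%N * enorm (z - z') /\
     ((t < horizon pb)%N ->
      enorm (s.2 t - s'.2 t) <= q3 (t - t1)%N * enorm (z - z'))).

Definition property_P (R : realType) (n m : nat) (pb : ocp R n m)
    (k : nat) (opt : traj R n m) (rad : R) (q1 q2 q3 : nat -> R)
    (C1 C2 C3 : R) : Prop :=
  [/\ 0 < rad,
      [/\ gain_bounded q1 C1, gain_bounded q2 C2 & gain_bounded q3 C3],
      (q1 @ \oo --> (0 : R)) /\ (q2 @ \oo --> (0 : R)),
      prop_a_indicator pb k opt rad q1 q2 /\ prop_a_terminal pb k opt rad q1 q2
    & prop_b pb opt rad q3].

(* Main.v *)
Require Import Defs.
From mathcomp Require Import all_boot all_order all_algebra.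
From mathcomp Require Import zify ring lra.
From mathcomp Require Import all_classical all_reals all_analysis.
Import Order.TTheory GRing.Theory Num.Theory.
Import numFieldNormedType.Exports.
Local Open Scope classical_set_scope.
Local Open Scope ring_scope.

(** The optimal tail problems contract the effect of a mistake.  Let P_i be the
    plan that is optimal from the state x_i reached at time i.  The plans P_i
    and P_(i+1) agree at time i.+1 up to the one-step effect Lg * e_i of the
    action error, because the suffix of P_i is itself optimal from where P_i
    arrives (Bellman's principle, [tail_opt_suffix]).  The perturbation
    bound [prop_b] therefore makes them differ at time t by at most
    q3 (t - i.+1) * Lg * e_i.  Telescoping from P_0, which is the optimal
    trajectory, to the state x_t gives
      |x_t - x*_t| <= sum_(i < t) q3 (t - i.+1) * Lg * e_i
    ([state_deviation]).  The weights sum to at most C3, so small errors keep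
    x_t within rad / C3 of x*_t; an induction on t makes [prop_b] applicable at
    every stage ([state_in_ball]).

    The right-hand side is a convolution of the summable q3 with Lg * e, so
    Young's inequality bounds the sum of squared state deviations by
    (C3 * Lg)^2 times the sum of squared errors
    ([convolution_sqr_sum_le]).  The action deviation is at most e_t plus C3
    times the state deviation, which gives the same kind of bound for
    state-action pairs ([total_deviation]).

    A nonnegative L-smooth function satisfies |grad h|^2 <= 4 L h, whence
      h w' <= (1 + eta) * h w + L * (1 + 1 / eta) * |w' - w|^2
    for all eta > 0 ([smooth_perturbation]).  Summing over the stage costs and
    the terminal cost, and then choosing eta of order sqrt (E / cost(OPT)),
    where E is the sum of squared errors, yields the regret bound
    ([regret_of_tradeoff]).  The bound for fixed eta is linear in the costs and
    the squared deviations, which is what lets it be summed before eta is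
    chosen. *)

(** * Euclidean geometry *)

Definition dot {R : realType} {d : nat} (x y : 'cV[R]_d) : R :=
  \sum_(i < d) x i ord0 * y i ord0.

Lemma enorm_ge0 {R : realType} {d : nat} (x : 'cV[R]_d) : 0 <= enorm x.
Proof. exact: sqrtr_ge0. Qed.

Lemma enorm_sqr {R : realType} {d : nat} (x : 'cV[R]_d) :
  enorm x ^+ 2 = dot x x.
Proof.
rewrite /enorm sqr_sqrtr; first by apply: eq_bigr => i _; rewrite expr2.
by apply: sumr_ge0 => i _; exact: sqr_ge0.
Qed.

Lemma enormN {R : realType} {d : nat} (x : 'cV[R]_d) : enorm (- x) = enorm x.
Proof.
by rewrite /enorm; congr Num.sqrt; apply: eq_bigr => i _; rewrite mxE sqrrN.
Qed.

Lemma enormZ {R : realType} {d : nat} (a : R) (x : 'cV[R]_d) :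
  0 <= a -> enorm (a *: x) = a * enorm x.
Proof.
move=> a0; rewrite /enorm -{2}(ger0_norm a0) -sqrtr_sqr.
rewrite -sqrtrM ?sqr_ge0 // mulr_sumr; congr Num.sqrt.
by apply: eq_bigr => i _; rewrite mxE exprMn.
Qed.

Lemma enorm0 {R : realType} (d : nat) : enorm (0 : 'cV[R]_d) = 0.
Proof. by rewrite -(scale0r 0) enormZ // mul0r. Qed.

Lemma enorm_col_mx {R : realType} {n m : nat} (x : 'cV[R]_n) (u : 'cV[R]_m) :
  enorm (col_mx x u) ^+ 2 = enorm x ^+ 2 + enorm u ^+ 2.
Proof.
rewrite !enorm_sqr /dot big_split_ord /=.
by congr (_ + _); apply: eq_bigr => i _; rewrite ?col_mxEu ?col_mxEd.
Qed.

Lemma dotDl {R : realType} {d : nat} (x y z : 'cV[R]_d) :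
  dot (x + y) z = dot x z + dot y z.
Proof.
by rewrite /dot -big_split; apply: eq_bigr => i _; rewrite mxE mulrDl.
Qed.

Lemma dotZr {R : realType} {d : nat} (a : R) (x y : 'cV[R]_d) :
  dot x (a *: y) = a * dot x y.
Proof.
by rewrite /dot mulr_sumr; apply: eq_bigr => i _; rewrite mxE mulrCA.
Qed.

Lemma enormD_sqr {R : realType} {d : nat} (x y : 'cV[R]_d) :
  enorm (x + y) ^+ 2 = enorm x ^+ 2 + 2 * dot x y + enorm y ^+ 2.
Proof.
rewrite !enorm_sqr /dot mulr_sumr -!big_split.
by apply: eq_bigr => i _ /=; rewrite mxE; ring.
Qed.

(** Expand the square of a x - b y.  Both scalars are kept free so that the
    same inequality yields Cauchy-Schwarz (balanced weights) and the trade-off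
    between gradient and displacement (unbalanced weights). *)
Lemma dot_young {R : realType} {d : nat} (a b : R) (x y : 'cV[R]_d) :
  2 * a * b * dot x y <= a ^+ 2 * enorm x ^+ 2 + b ^+ 2 * enorm y ^+ 2.
Proof.
rewrite !enorm_sqr /dot !mulr_sumr -big_split /=.
apply: ler_sum => i _; rewrite -subr_ge0.
rewrite [leRHS](_ : _ = (a * x i ord0 - b * y i ord0) ^+ 2).
  exact: sqr_ge0.
by ring.
Qed.

Lemma enorm0_eq0 {R : realType} {d : nat} (x : 'cV[R]_d) : enorm x = 0 -> x = 0.
Proof.
move=> x0; apply/matrixP => i j; rewrite ord1 mxE.
have : enorm x ^+ 2 = 0 by rewrite x0 expr0n.
rewrite enorm_sqr => /eqP; rewrite psumr_eq0; last first.
  by move=> k _; rewrite -expr2 sqr_ge0.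
by move=> /allP/(_ i (mem_index_enum _)); rewrite /= mulf_eq0 orbb => /eqP.
Qed.

Lemma dot_le_enorm {R : realType} {d : nat} (x y : 'cV[R]_d) :
  dot x y <= enorm x * enorm y.
Proof.
have [/enorm0_eq0 x0|x0] := eqVneq (enorm x) 0.
  by rewrite x0 enorm0 mul0r /dot big1 // => i _; rewrite mxE mul0r.
have [/enorm0_eq0 y0|y0] := eqVneq (enorm y) 0.
  by rewrite y0 enorm0 mulr0 /dot big1 // => i _; rewrite mxE mulr0.
have xy0 : 0 < 2 * enorm y * enorm x.
  by rewrite !mulr_gt0 // lt0r ?x0 ?y0 enorm_ge0.
rewrite -(ler_pM2l xy0); apply: le_trans (dot_young _ _ _ _) _.
rewrite le_eqVlt; apply/orP; left; apply/eqP; ring.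
Qed.

Lemma enorm_triangle {R : realType} {d : nat} (x y : 'cV[R]_d) :
  enorm (x + y) <= enorm x + enorm y.
Proof.
rewrite -ler_sqr ?nnegrE ?addr_ge0 ?enorm_ge0 // enormD_sqr sqrrD.
by have := dot_le_enorm x y; lra.
Qed.

Lemma enorm_dist_triangle {R : realType} {d : nat} (y x z : 'cV[R]_d) :
  enorm (x - z) <= enorm (x - y) + enorm (y - z).
Proof. by rewrite -(subrKA y); exact: enorm_triangle. Qed.

(** * Nonnegative smooth functions *)

Lemma derive_gradient {R : realType} {d : nat} (h : 'cV[R]_d -> R)
    (w v : 'cV[R]_d) :
  differentiable h w -> 'D_v h w = dot (gradient h w) v.
Proof.
move=> dh; rewrite deriveE // /dot.
rewrite {1}(matrix_sum_delta v) linear_sum; apply: eq_bigr => i _ /=.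
by rewrite big_ord1 linearZ /= /gradient mxE deriveE // mulrC.
Qed.

Lemma gradient_mvt {R : realType} {d : nat} (h : 'cV[R]_d -> R)
    (w v : 'cV[R]_d) :
  (forall w, differentiable h w) ->
  exists2 c : R, 0 <= c <= 1
  & h (w + v) - h w = dot (gradient h (w + c *: v)) v.
Proof.
move=> dh.
pose phi (s : R) := h (w + s *: v).
have dphi (s : R) : is_derive s 1 phi (dot (gradient h (w + s *: v)) v).
  have E : (fun r : R => r^-1 *: ((phi \o shift s) (r *: (1 : R)) - phi s)) =
           (fun r : R => r^-1 *: ((h \o shift (w + s *: v)) (r *: v)
                                  - h (w + s *: v))).
    apply/funext => r; rewrite /phi /=; congr (_ *: (h _ - _)).
    by rewrite scalerDl /GRing.scale /= mulr1 addrCA.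
  split; first by rewrite /derivable E; exact: diff_derivable.
  by rewrite /derive E -derive_gradient.
have [|c c01] := @MVT R phi _ 0 1 ltr01 (fun x _ => dphi x).
  by apply: derivable_within_continuous => x _; exact: @ex_derive.
rewrite subr0 mulr1 /phi scale1r scale0r addr0 => E.
by exists c => //; move: c01; rewrite in_itv /= => /andP[/ltW -> /ltW ->].
Qed.

(** The quadratic upper bound of a smooth function, with L in place of the
    sharp L / 2: the mean value theorem compares the gradient at w with the one
    at a single intermediate point, at distance at most |v|. *)
Lemma smooth_upper_bound {R : realType} {d : nat} (L : R) (h : 'cV[R]_d -> R)
    (w v : 'cV[R]_d) :
  0 < L -> smooth L h ->
  h (w + v) <= h w + dot (gradient h w) v + L * enorm v ^+ 2.
Proof.
move=> L0 [dh lip]; have [c /andP[c0 c1] E] := gradient_mvt h w v dh.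
have lipc : enorm (gradient h (w + c *: v) - gradient h w) <= L * enorm v.
  apply: le_trans (lip _ _) _; rewrite addrC addKr enormZ //.
  by rewrite ler_pM2l // ler_piMl // enorm_ge0.
have := dot_le_enorm (gradient h (w + c *: v) - gradient h w) v.
have := ler_wpM2r (enorm_ge0 v) lipc.
have := dotDl (gradient h (w + c *: v) - gradient h w) (gradient h w) v.
rewrite subrK -E; lra.
Qed.

(** A gradient step of length 1 / (2 L) lowers h by at least
    |grad h|^2 / (4 L), and h cannot become negative. *)
Lemma gradient_self_bounding {R : realType} {d : nat} (L : R)
    (h : 'cV[R]_d -> R) (w : 'cV[R]_d) :
  0 < L -> (forall w, 0 <= h w) -> smooth L h ->
  enorm (gradient h w) ^+ 2 <= 4 * L * h w.
Proof.
move=> L0 h0 hL; set g := gradient h w.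
have := le_trans (h0 _) (smooth_upper_bound L h w (- (2 * L)^-1 *: g) L0 hL).
rewrite -/g dotZr -enorm_sqr scaleNr enormN enormZ ?invr_ge0; last by lra.
rewrite [leRHS](_ : _ = h w - enorm g ^+ 2 / (4 * L)); last by field; lra.
by rewrite subr_ge0 ler_pdivrMr ?mulr_gt0 // mulrC.
Qed.

(** Weighting the linear term of the quadratic upper bound against
    |grad h|^2 <= 4 L h costs a fraction eta of h itself.  In this form the
    bound is linear in h w and in the squared distance, hence can be summed. *)
Lemma smooth_perturbation {R : realType} {d : nat} (L eta : R)
    (h : 'cV[R]_d -> R) (w w' : 'cV[R]_d) :
  0 < L -> 0 < eta -> (forall w, 0 <= h w) -> smooth L h ->
  h w' <= (1 + eta) * h w + L * (1 + eta^-1) * enorm (w' - w) ^+ 2.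
Proof.
move=> L0 eta0 h0 hL; set v := w' - w.
have := smooth_upper_bound L h w v L0 hL; rewrite addrC subrK.
have := gradient_self_bounding L h w L0 h0 hL; set g := gradient h w => gb.
have : dot g v <= eta / (4 * L) * enorm g ^+ 2 + L / eta * enorm v ^+ 2.
  have := dot_young 1 (2 * L / eta) g v.
  rewrite -(ler_pM2l (_ : 0 < eta / (4 * L))) ?divr_gt0 ?mulr_gt0 //.
  rewrite [leLHS](_ : _ = dot g v); last by field; lra.
  move/le_trans; apply; rewrite le_eqVlt; apply/orP; left; apply/eqP.
  by field; lra.
have : eta / (4 * L) * enorm g ^+ 2 <= eta * h w.
  rewrite mulrAC ler_pdivrMr ?mulr_gt0 // -mulrA ler_pM2l //.
  by rewrite mulrC.
lra.
Qed.

(** * Summable gains *)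

Lemma gain_sum_le {R : realType} {q : nat -> R} {C : R} (N : nat) :
  gain_bounded q C -> \sum_(0 <= j < N) q j <= C.
Proof.
move=> [q0 _ qC]; rewrite -lee_fin -sumEFin; apply: le_trans qC.
by apply: nneseries_lim_ge => j _ _; rewrite lee_fin.
Qed.

Lemma gain_le {R : realType} {q : nat -> R} {C : R} (j : nat) :
  gain_bounded q C -> q j <= C.
Proof.
move=> qC; apply: le_trans (gain_sum_le j.+1 qC).
by rewrite big_nat_recr //= ler_wpDl // sumr_ge0 // => i _; case: qC.
Qed.

Lemma gain_past_sum_le {R : realType} {q : nat -> R} {C : R} (t : nat) :
  gain_bounded q C -> \sum_(0 <= tau < t) q (t - tau.+1)%N <= C.
Proof.
move=> qC; rewrite big_nat_rev /= add0n.
apply: le_trans (gain_sum_le t qC); apply: ler_sum_nat => i /andP[_ it].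
by rewrite (_ : _ - _ = i)%N //; lia.
Qed.

Lemma gain_future_sum_le {R : realType} {q : nat -> R} {C : R} (tau N : nat) :
  gain_bounded q C -> \sum_(0 <= t < N | (tau < t)%N) q (t - tau.+1)%N <= C.
Proof.
move=> qC; rewrite -(@big_nat_widenl _ _ _ tau.+1 0 N predT) //.
rewrite -{1}(add0n tau.+1) big_addn.
apply: le_trans (gain_sum_le (N - tau.+1) qC).
by apply: ler_sum_nat => i _; rewrite addnK.
Qed.

(** Jensen for the square with weights w of total mass at most C: the
    weighted sum of the squares of C a - m, where m is the weighted sum of a, is
    nonnegative. *)
Lemma sqr_weighted_sum_le {R : realType} (C : R) (t : nat) (w a : nat -> R) :
  0 < C -> (forall i, 0 <= w i) -> \sum_(0 <= i < t) w i <= C ->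
  (\sum_(0 <= i < t) w i * a i) ^+ 2 <= C * \sum_(0 <= i < t) w i * a i ^+ 2.
Proof.
move=> C0 w0 wC; set m := \sum_(_ <= _ < _) _; set S := \sum_(_ <= _ < _) _.
have : 0 <= \sum_(0 <= i < t) w i * (C * a i - m) ^+ 2.
  by apply: sumr_ge0 => i _; rewrite mulr_ge0 ?sqr_ge0.
rewrite (_ : \sum_(_ <= _ < _) _ =
    C ^+ 2 * S - 2 * C * m * m + m ^+ 2 * \sum_(0 <= i < t) w i); last first.
  under eq_bigr => i _.
    rewrite (_ : _ * _ = C ^+ 2 * (w i * a i ^+ 2) - 2 * C * m * (w i * a i)
                         + m ^+ 2 * w i); last by ring.
  over.
  by rewrite big_split sumrB /= -!mulr_sumr.
have := ler_wpM2l (sqr_ge0 m) wC => h1 h2.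
rewrite -(ler_pM2l C0); nra.
Qed.

(** Young's inequality for the convolution of the summable q with the
    square-summable a.  One factor C comes from Jensen in each row, the other
    from exchanging the two sums. *)
Lemma convolution_sqr_sum_le {R : realType} {q : nat -> R} {C : R} (N : nat)
    (a : nat -> R) :
  gain_bounded q C ->
  \sum_(0 <= t < N.+1) (\sum_(0 <= tau < t) q (t - tau.+1)%N * a tau) ^+ 2 <=
  C ^+ 2 * \sum_(0 <= tau < N) a tau ^+ 2.
Proof.
move=> qC; have [q0 C1 _] := qC; have C0 : 0 < C by lra.
have step t : (\sum_(0 <= tau < t) q (t - tau.+1)%N * a tau) ^+ 2 <=
    C * \sum_(0 <= tau < t) q (t - tau.+1)%N * a tau ^+ 2.
  by apply: sqr_weighted_sum_le => //; exact: gain_past_sum_le.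
apply: le_trans (ler_sum _ (fun t _ => step t)) _.
rewrite -mulr_sumr expr2 -mulrA ler_pM2l //.
under eq_big_nat => t /andP[_ tN].
  rewrite (big_nat_widen _ _ N) //=.
over.
rewrite (exchange_big_dep_nat predT) //= mulr_sumr.
apply: ler_sum => tau _; rewrite -mulr_suml ler_wpM2r ?sqr_ge0 //.
exact: gain_future_sum_le.
Qed.

(** * Perturbation of optimal tails *)

(** Bellman's principle: a cheaper continuation from s.1 t2, glued to the
    beginning of s, would be a cheaper solution of the longer problem. *)
Lemma tail_opt_suffix {R : realType} {n m : nat} {pb : ocp R n m}
    {xi : param_seq pb} {t1 t2 : nat} {z : 'cV[R]_n} {s : traj R n m} :
  (t1 <= t2 <= horizon pb)%N -> tail_opt t1 z xi s ->
  tail_opt t2 (s.1 t2) xi s.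
Proof.
move=> /andP[t12 t2T] [[sz sf] _ smin]; split.
- by split=> // t /andP[t2t tT]; apply: sf; rewrite tT (leq_trans t12).
- by rewrite /ftocp_cost /terminal_cost -EFinD ltry.
move=> s' [s'z s'f].
pose r : traj R n m := (fun t => if (t < t2)%N then s.1 t else s'.1 t,
                        fun t => if (t < t2)%N then s.2 t else s'.2 t).
have rf : ftocp_feasible t1 (horizon pb) z xi r.
  split=> [|t /andP[t1t tT]] /=.
    case: ltnP => // t21; rewrite -sz (_ : t1 = t2) //.
    by apply/eqP; rewrite eqn_leq t12.
  case: (ltnP t t2) => tt2; last first.
    by rewrite ltnNge (leqW tt2) /=; apply: s'f; rewrite tt2.
  have [] := sf t; first by rewrite t1t.
  move=> st sc; split=> //; rewrite -st.
  case: ltnP => // t2t; rewrite (_ : t.+1 = t2) //.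
  by apply/eqP; rewrite eqn_leq tt2.
pose c (u : traj R n m) t := stage_cost (u.1 t) (u.2 t) (xi t).
have split_cost u : \sum_(t1 <= t < horizon pb) c u t =
    \sum_(t1 <= t < t2) c u t + \sum_(t2 <= t < horizon pb) c u t.
  exact: big_cat_nat.
have head : \sum_(t1 <= t < t2) c r t = \sum_(t1 <= t < t2) c s t.
  by apply: eq_big_nat => t /andP[_ tt2]; rewrite /c /r /= tt2.
have tail : \sum_(t2 <= t < horizon pb) c r t =
    \sum_(t2 <= t < horizon pb) c s' t.
  by apply: eq_big_nat => t /andP[tt2 _]; rewrite /c /r /= ltnNge tt2.
have rT : r.1 (horizon pb) = s'.1 (horizon pb) by rewrite /r /= ltnNge t2T.
have := smin r rf; rewrite /ftocp_cost /terminal_cost -!EFinD !lee_fin rT.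
by rewrite -/(c s) -/(c r) -/(c s') !split_cost head tail -!addrA lerD2l.
Qed.

Lemma psi_tail_opt {R : realType} {n m : nat} {pb : ocp R n m}
    {opt : traj R n m} {rad : R} {q : nat -> R} {t : nat} {z : 'cV[R]_n} :
  prop_b pb opt rad q -> (t < horizon pb)%N -> eball (opt.1 t) rad z ->
  tail_opt t z (xi_true pb) (psi_tail t z (xi_true pb)).
Proof. by move=> [ex _] tT zb; apply: xgetPex; exact: ex. Qed.

Lemma tail_opt_is_OPT {R : realType} {n m : nat} {pb : ocp R n m}
    {opt : traj R n m} {t : nat} :
  is_OPT pb opt -> (t <= horizon pb)%N -> tail_opt t (opt.1 t) (xi_true pb) opt.
Proof. by move=> H tT; apply: tail_opt_suffix H. Qed.

Lemma eball_center {R : realType} {d : nat} (x : 'cV[R]_d) (r : R) :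
  0 <= r -> eball x r x.
Proof. by move=> r0; rewrite /eball /= subrr enorm0. Qed.

(** At the initial time of a tail problem the state entry of a solution is the
    initial state itself, so [prop_b] at lag 0 compares |z - z'| with itself.
    Rescaling to fit the ball removes the restriction on the length of v.  The
    statement is |v| <= q 0 |v| rather than 1 <= q 0, which may fail when the
    state space has dimension 0. *)
Lemma le_gain0_mul {R : realType} {n m : nat} {pb : ocp R n m}
    {opt : traj R n m} {rad : R} {q : nat -> R} (v : 'cV[R]_n) :
  0 < rad -> (0 < horizon pb)%N -> prop_b pb opt rad q ->
  enorm v <= q 0%N * enorm v.
Proof.
move=> rad0 T0 [ex pert].
have [->|v0] := eqVneq (enorm v) 0; first by rewrite mulr0.
have vp : 0 < enorm v by rewrite lt0r v0 enorm_ge0.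
pose a := rad / enorm v; have a0 : 0 < a by exact: divr_gt0.
pose z := opt.1 0%N + a *: v; pose z' := opt.1 0%N.
have zz' : z - z' = a *: v by rewrite /z /z' addrC addKr.
have zb : eball (opt.1 0%N) rad z.
  by rewrite /eball /= -/z' zz' (enormZ _ _ (ltW a0)) /a divfK // lexx.
have z'b : eball (opt.1 0%N) rad z' by exact: eball_center (ltW rad0).
have [s sopt] := ex 0%N z T0 zb; have [s' s'opt] := ex 0%N z' T0 z'b.
have [+ _] := pert 0%N z z' s s' 0%N T0 zb z'b sopt s'opt (leq0n _).
case: sopt => [[-> _] _ _]; case: s'opt => [[-> _] _ _].
by rewrite subnn zz' (enormZ _ _ (ltW a0)) mulrCA ler_pM2l.
Qed.

Definition closed_loop {R : realType} {n m : nat} (pb : ocp R n m)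
    (s : traj R n m) : Prop :=
  s.1 0%N = x_init pb /\
  forall t, s.1 t.+1 = dynamics (s.1 t) (s.2 t) (xi_true pb t).

Lemma one_step_deviation {R : realType} {n m : nat} {pb : ocp R n m}
    {s y : traj R n m} {Lg : R} {t : nat} :
  closed_loop pb s -> dynamics_lipschitz pb s Lg -> (t < horizon pb)%N ->
  tail_opt t (s.1 t) (xi_true pb) y ->
  enorm (s.1 t.+1 - y.1 t.+1) <= Lg * enorm (s.2 t - y.2 t).
Proof.
move=> [_ sdyn] lip tT [[yt yf] _ _].
have [|ydyn ysat] := yf t; first by rewrite leqnn.
rewrite sdyn ydyn yt; apply: lip => //; first by right.
by left; rewrite -yt.
Qed.

(** * Tracking the optimal trajectory *)

Section Tracking.
Context {R : realType} {n m : nat} {pb : ocp R n m} {s opt : traj R n m}.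
Context {Lg C3 rad : R} {q : nat -> R}.
Context (rad0 : 0 < rad) (qC : gain_bounded q C3) (Lg0 : 0 < Lg).
Context (sloop : closed_loop pb s) (lip : dynamics_lipschitz pb s Lg).
Context (sopt : is_OPT pb opt) (pert : prop_b pb opt rad q).
Notation T := (horizon pb).
Notation e := (step_error pb s).

Let C3_gt0 : 0 < C3. Proof. by case: qC => _ C1 _; lra. Qed.

Let inner_ball (z x : 'cV[R]_n) : enorm (z - x) <= rad / C3 -> eball x rad z.
Proof.
rewrite /eball /= => /le_trans; apply; rewrite ler_pdivrMr //.
by case: qC => _ C1 _; rewrite ler_peMr // ltW.
Qed.

(** The induction on i replaces the plan made at time i by the one made at
    time i.+1; both solve the tail problem at i.+1, from initial states that
    differ by the one-step effect of the action error. *)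
Lemma planned_state_deviation (t i : nat) :
  (t <= T)%N ->
  (forall tau, (tau < t)%N -> enorm (s.1 tau - opt.1 tau) <= rad / C3) ->
  (i < t)%N ->
  enorm ((psi_tail i (s.1 i) (xi_true pb)).1 t - opt.1 t) <=
  \sum_(0 <= tau < i) q (t - tau.+1)%N * (Lg * e tau).
Proof.
move=> tT near; have [_ bnd] := pert.
pose P i := psi_tail i (s.1 i) (xi_true pb); rewrite -/(P i).
have Popt j : (j < t)%N -> tail_opt j (s.1 j) (xi_true pb) (P j).
  move=> jt; apply: (psi_tail_opt pert); first exact: leq_trans tT.
  exact: inner_ball (near j jt).
elim: i => [|i IH] it.
  (* The plan made at time 0 and opt solve the same problem; [prop_b] with
     equal initial states forces their entries to coincide. *)
  have xb : eball (opt.1 0%N) rad (x_init pb).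
    by rewrite -sloop.1; apply: inner_ball; exact: near.
  have P0 := Popt 0%N it; rewrite sloop.1 in P0.
  have [+ _] := bnd 0%N _ _ _ _ t (leq_trans it tT) xb xb P0 sopt tT.
  by rewrite big_geq // subrr enorm0 mulr0.
have iT : (i.+1 < T)%N := leq_trans it tT.
have it' : (i < t)%N := ltnW it.
rewrite big_nat_recr //= [leRHS]addrC.
apply: le_trans (enorm_dist_triangle ((P i).1 t) _ _) _; apply: lerD (IH it').
(* Membership at radius rad is where the slack rad / C3 is spent: one step
   under [prop_b] may expand distances by q 1 <= C3. *)
have Pb : eball (opt.1 i.+1) rad ((P i).1 i.+1).
  have ii : (i <= i.+1 <= T)%N by rewrite leqnSn ltnW.
  have [+ _] := bnd i _ _ _ _ i.+1 (ltnW iT) (inner_ball _ _ (near i it'))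
    (eball_center _ _ (ltW rad0)) (Popt i it')
    (tail_opt_is_OPT sopt (ltnW (ltnW iT))) ii.
  move=> /le_trans; apply; rewrite subSnn.
  rewrite -[leRHS](divfK (lt0r_neq0 C3_gt0)) mulrC; apply: ler_pM.
  - exact: enorm_ge0.
  - by case: qC.
  - exact: near.
  - exact: gain_le qC.
have ii : (i <= i.+1 <= T)%N by rewrite leqnSn ltnW.
have itT : (i < t <= T)%N by rewrite it'.
have [+ _] := bnd i.+1 _ _ _ _ t iT (inner_ball _ _ (near _ it)) Pb (Popt _ it)
  (tail_opt_suffix ii (Popt _ it')) itT.
move=> /le_trans; apply.
apply: ler_wpM2l; first by case: qC.
exact: (one_step_deviation sloop lip (ltnW iT) (Popt _ it')).
Qed.

(** The last plan, made at time t.-1, is compared directly with the state at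
    time t: that step has no gain factor of its own, and [le_gain0_mul] supplies
    the factor q 0 so that all lags have the same form. *)
Lemma state_deviation (t : nat) :
  (t <= T)%N ->
  (forall tau, (tau < t)%N -> enorm (s.1 tau - opt.1 tau) <= rad / C3) ->
  enorm (s.1 t - opt.1 t) <=
  \sum_(0 <= tau < t) q (t - tau.+1)%N * (Lg * e tau).
Proof.
case: t => [_ _|t tT near].
  by case: sopt => [[-> _] _ _]; rewrite sloop.1 big_geq // subrr enorm0.
rewrite big_nat_recr //= [leRHS]addrC subnn.
apply: le_trans
  (enorm_dist_triangle ((psi_tail t (s.1 t) (xi_true pb)).1 t.+1) _ _) _.
apply: lerD; last exact: planned_state_deviation.
apply: le_trans (le_gain0_mul _ rad0 (leq_ltn_trans (leq0n _) tT) pert) _.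
apply: ler_wpM2l; first by case: qC.
apply: (one_step_deviation sloop lip tT).
exact: (psi_tail_opt pert tT (inner_ball _ _ (near t (ltnSn t)))).
Qed.

(** The errors are small enough for the convolution bound to reproduce the
    radius rad / C3: C3 * Lg * (rad / (C3^2 Lg)) = rad / C3. *)
Lemma state_in_ball (t : nat) :
  (t <= T)%N ->
  (forall tau, (tau < t)%N -> e tau <= rad / (C3 ^+ 2 * Lg)) ->
  enorm (s.1 t - opt.1 t) <= rad / C3.
Proof.
elim/ltn_ind: t => t IH tT small.
apply: le_trans (state_deviation t tT _) _.
  move=> tau taut; apply: IH => // [|tau' tt].
    exact: ltnW (leq_trans taut tT).
  exact: small (ltn_trans tt taut).
have -> : rad / C3 = C3 * (rad / C3 ^+ 2) by field; rewrite lt0r_neq0.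
have r0 : 0 <= rad / C3 ^+ 2 by rewrite divr_ge0 ?sqr_ge0 ?ltW.
apply: le_trans (ler_wpM2r r0 (gain_past_sum_le t qC)).
rewrite mulr_suml; apply: ler_sum_nat => tau /andP[_ taut].
apply: ler_wpM2l; first by case: qC.
apply: le_trans (ler_wpM2l (ltW Lg0) (small tau taut)) _.
by rewrite le_eqVlt; apply/orP; left; apply/eqP; field; rewrite !lt0r_neq0.
Qed.

Lemma action_deviation (t : nat) :
  (t < T)%N -> enorm (s.1 t - opt.1 t) <= rad / C3 ->
  enorm (s.2 t - opt.2 t) <= e t + C3 * enorm (s.1 t - opt.1 t).
Proof.
move=> tT near; have [_ bnd] := pert; have xb := inner_ball _ _ near.
apply: le_trans
  (enorm_dist_triangle ((psi_tail t (s.1 t) (xi_true pb)).2 t) _ _) _.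
rewrite lerD2l.
have tt : (t <= t <= T)%N by rewrite leqnn ltnW.
have [_ +] := bnd t _ _ _ _ t tT xb (eball_center _ _ (ltW rad0))
  (psi_tail_opt pert tT xb) (tail_opt_is_OPT sopt (ltnW tT)) tt.
move=> /(_ tT) /le_trans; apply; rewrite subnn.
by apply: ler_wpM2r; [exact: enorm_ge0|exact: gain_le qC].
Qed.

(** The states contribute (C3 Lg)^2 by the convolution inequality; each action
    contributes twice its own squared error and 2 C3^2 times the squared state
    deviation. *)
Lemma total_deviation :
  (forall t, (t < T)%N -> e t <= rad / (C3 ^+ 2 * Lg)) ->
  \sum_(0 <= t < T)
     (enorm (s.1 t - opt.1 t) ^+ 2 + enorm (s.2 t - opt.2 t) ^+ 2)
  + enorm (s.1 T - opt.1 T) ^+ 2 <=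
  (2 + (1 + 2 * C3 ^+ 2) * (C3 * Lg) ^+ 2) * \sum_(0 <= t < T) e t ^+ 2.
Proof.
move=> small; set E := \sum_(0 <= t < T) _ ^+ 2.
pose a t := enorm (s.1 t - opt.1 t).
have near t : (t <= T)%N -> a t <= rad / C3.
  move=> tT; apply: state_in_ball => // tau taut; apply: small.
  exact: leq_trans tT.
have states : \sum_(0 <= t < T.+1) a t ^+ 2 <= (C3 * Lg) ^+ 2 * E.
  have -> : (C3 * Lg) ^+ 2 * E = C3 ^+ 2 * \sum_(0 <= t < T) (Lg * e t) ^+ 2.
    rewrite /E !mulr_sumr; apply: eq_bigr => t _; ring.
  apply: le_trans (convolution_sqr_sum_le T _ qC).
  apply: ler_sum_nat => t /andP[_ tT].
  have H : a t <= \sum_(0 <= tau < t) q (t - tau.+1)%N * (Lg * e tau).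
    apply: state_deviation => // tau taut; apply: near.
    exact: ltnW (leq_trans taut tT).
  by rewrite ler_sqr ?nnegrE ?enorm_ge0 // (le_trans (enorm_ge0 _) H).
have actions : \sum_(0 <= t < T) enorm (s.2 t - opt.2 t) ^+ 2 <=
    2 * E + 2 * C3 ^+ 2 * \sum_(0 <= t < T) a t ^+ 2.
  rewrite !mulr_sumr -big_split /=; apply: ler_sum_nat => t /andP[_ tT].
  have := action_deviation t tT (near t (ltnW tT)); rewrite -/(a t) => H.
  apply: (@le_trans _ _ ((e t + C3 * a t) ^+ 2)).
    by rewrite ler_sqr ?nnegrE ?enorm_ge0 // (le_trans (enorm_ge0 _) H).
  by have := sqr_ge0 (e t - C3 * a t); lra.
have states' : \sum_(0 <= t < T) a t ^+ 2 + a T ^+ 2 <= (C3 * Lg) ^+ 2 * E.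
  by rewrite -big_nat_recr.
rewrite big_split /=.
have aT := sqr_ge0 (a T); have := sqr_ge0 C3.
move: states' actions; rewrite -/(a T) /=.
set A := \sum_(0 <= t < T) a t ^+ 2; set U := \sum_(_ <= _ < _) _ => h1 h2 c0.
have := ler_wpM2l c0 (le_trans (_ : A <= A + a T ^+ 2) h1).
rewrite lerDl => /(_ aT) => h3.
rewrite -/A; lra.
Qed.

End Tracking.

(** * From deviations to regret *)

(** Sums [smooth_perturbation] over the costs.  Smoothness of a stage cost is
    joint in state and action, so deviations are measured on the stacked
    vector, whose squared norm splits. *)
Lemma cost_perturbation {R : realType} {n m : nat} {pb : ocp R n m}
    {ell L eta : R} (s s' : traj R n m) :
  ell <= L -> 0 < L -> 0 < eta -> costs_regular pb ell ->
  cost pb s <= (1 + eta) * cost pb s' + L * (1 + eta^-1) *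
    (\sum_(0 <= t < horizon pb)
       (enorm (s.1 t - s'.1 t) ^+ 2 + enorm (s.2 t - s'.2 t) ^+ 2)
     + enorm (s.1 (horizon pb) - s'.1 (horizon pb)) ^+ 2).
Proof.
move=> ellL L0 eta0 [stage term].
have smoothL d (h : 'cV[R]_d -> R) : smooth ell h -> smooth L h.
  move=> [dh lip]; split=> // w w'; apply: le_trans (lip w w') _.
  by rewrite ler_wpM2r ?enorm_ge0.
pose M := L * (1 + eta^-1).
rewrite /cost -/M !mulrDr !mulr_sumr addrACA -big_split /=.
apply: lerD; last first.
  case: term => h0 _ /smoothL hL.
  exact: (smooth_perturbation L eta _ _ _ L0 eta0 h0 hL).
apply: ler_sum_nat => t /andP[_ tT].
case: (stage t tT) => h0 _ /smoothL hL.
have := smooth_perturbation L eta _ (col_mx (s'.1 t) (s'.2 t))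
  (col_mx (s.1 t) (s.2 t)) L0 eta0 h0 hL.
by rewrite !col_mxKu !col_mxKd opp_col_mx add_col_mx enorm_col_mx.
Qed.

(** The best eta is of order sqrt (E / c); it is degenerate when E = 0 (eta
    tends to 0) or c = 0 (any fixed eta will do). *)
Lemma regret_of_tradeoff {R : realType} (c E B r : R) :
  0 <= c -> 0 <= E -> 0 <= B ->
  (forall eta, 0 < eta -> r <= eta * c + B * (1 + eta^-1) * E) ->
  r <= (1 + 2 * B) * (Num.sqrt (c * E) + E).
Proof.
move=> c0 E0 B0 H; have s0 := sqrtr_ge0 (c * E).
have BE := mulr_ge0 B0 E0; have Bs := mulr_ge0 B0 s0.
have [Ez|En] := eqVneq E 0.
  rewrite Ez mulr0 sqrtr0 addr0 mulr0; apply/ler_addgt0Pl => e e0.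
  rewrite addr0; have c1 : 0 < c + 1 by lra.
  have := H (e / (c + 1)) (divr_gt0 e0 c1).
  rewrite Ez mulr0 addr0 => /le_trans; apply.
  by rewrite mulrAC ler_pdivrMr // ler_pM2l //; lra.
have [cz|cn] := eqVneq c 0.
  by have := H 1 ltr01; rewrite cz mulr0 mul0r sqrtr0 invr1; lra.
have cp : 0 < c by rewrite lt0r cn.
have Ep : 0 < E by rewrite lt0r En.
have sp : 0 < Num.sqrt (c * E) by rewrite sqrtr_gt0 mulr_gt0.
have sE : Num.sqrt (c * E) ^+ 2 = c * E by rewrite sqr_sqrtr // mulr_ge0.
have := H (Num.sqrt (c * E) / c) (divr_gt0 sp cp).
set s := Num.sqrt _ in sp sE s0 Bs *.
have -> : s / c * c = s by field.
have -> : B * (1 + (s / c)^-1) * E = B * E + B * s.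
  have -> : B * s = B * (s ^+ 2 / s) by congr (_ * _); field; lra.
  by rewrite sE; field; lra.
lra.
Qed.

Theorem lemma3p2 (R : realType) (ell Lg C3 : R) :
  0 < Lg ->
  exists K : R,
  forall (n m : nat) (pb : ocp R n m) (k : nat) (opt : traj R n m)
    (D rad C1 C2 : R) (q1 q2 q3 : nat -> R)
    (ALG : controller pb k) (pred : nat -> param_seq pb),
  (1 <= k <= horizon pb)%N ->
  params_ok pb ->
  predictions_ok k pred ->
  is_OPT pb opt ->
  (forall t, (t <= horizon pb)%N -> enorm (opt.1 t) <= D) ->
  dynamics_lipschitz pb (alg_traj ALG pred) Lg ->
  costs_regular pb ell ->
  property_P pb k opt rad q1 q2 q3 C1 C2 C3 ->
  (forall t, (t <= horizon pb)%N ->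
     (forall tau, (tau < t)%N ->
        step_error pb (alg_traj ALG pred) tau <= rad / (C3 ^+ 2 * Lg)) ->
     eball (opt.1 t) (rad / C3) ((alg_traj ALG pred).1 t)) /\
  ((forall t, (t < horizon pb)%N ->
      step_error pb (alg_traj ALG pred) t <= rad / (C3 ^+ 2 * Lg)) ->
   cost pb (alg_traj ALG pred) - cost pb opt <=
     K * (Num.sqrt (cost pb opt *
            \sum_(0 <= t < horizon pb)
              step_error pb (alg_traj ALG pred) t ^+ 2)
          + \sum_(0 <= t < horizon pb)
              step_error pb (alg_traj ALG pred) t ^+ 2)).
Proof.
(* The smoothness constant ell need not be positive; L is a positive one. *)
move=> Lg0; pose L : R := `|ell| + 1.
pose B := L * (2 + (1 + 2 * C3 ^+ 2) * (C3 * Lg) ^+ 2).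
have L0 : 0 < L by rewrite ltr_wpDl.
have ellL : ell <= L by rewrite (le_trans (ler_norm _)) // lerDl.
have A0 : 0 <= 2 + (1 + 2 * C3 ^+ 2) * (C3 * Lg) ^+ 2.
  by have := sqr_ge0 C3; have := sqr_ge0 (C3 * Lg); nra.
exists (1 + 2 * B) => n m pb k opt D rad C1 C2 q1 q2 q3 ALG pred _ _ _ sopt
  _ lip reg [rad0 [_ _ qC] _ _ pert].
have sloop : closed_loop pb (alg_traj ALG pred) by split.
split=> [t tT small|small].
  exact: (state_in_ball rad0 qC Lg0 sloop lip sopt pert t tT small).
have dev := total_deviation rad0 qC Lg0 sloop lip sopt pert small.
apply: regret_of_tradeoff.
- rewrite /cost; case: reg => stage [h0 _ _]; apply: addr_ge0 (h0 _).
  rewrite big_nat; apply: sumr_ge0 => t /andP[_ tT].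
  case: (stage t tT) => /(_ (col_mx (opt.1 t) (opt.2 t))).
  by rewrite col_mxKu col_mxKd.
- by apply: sumr_ge0 => t _; exact: sqr_ge0.
- by rewrite mulr_ge0 // ltW.
move=> eta eta0.
have := cost_perturbation (alg_traj ALG pred) opt ellL L0 eta0 reg.
have c0 : 0 <= L * (1 + eta^-1).
  by rewrite mulr_ge0 ?addr_ge0 ?invr_ge0 // ltW.
have := ler_wpM2l c0 dev; rewrite /B; lra.
Qed.
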